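(* Let $s$, $t$ and $k$ be positive integers with $t\geq s$ and $k\geq 2$. Then \[ C_{k}(K_{s,t})=\begin{cases} 2, & \text{if } s<k;\\ 4, & \text{if } s=k;\\ t-k+3, & \text{if } k+1\leq s\leq 3k-2;\\ s+t-4k+4, & \text{if } s\geq 3k-1. \end{cases} \]
   Context: $K_{s,t}$ is the complete bipartite graph with partite sets of sizes $s$ and $t$. For a positive integer $k$, a set $S\subseteq V(G)$ is a $k$-dominating set of $G$ if every vertex $v\in V(G)\setminus S$ has at least $k$ neighbors in $S$. Two disjoint sets $A,B\subseteq V(G)$ form a $k$-coalition if neither $A$ nor $B$ is a $k$-dominating set of $G$ but $A\cup B$ is a $k$-dominating set of $G$. A $k$-coalition partition of $G$ is a partition $\Theta$ of $V(G)$ such that every set in $\Theta$ is either a $k$-dominating set of cardinality $k$ or forms a $k$-coalition with another set of $\Theta$. The $k$-coalition number $C_k(G)$ is the maximum cardinality of a $k$-coalition partition of $G$. *)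

(* Defs.v *)
From mathcomp Require Import all_boot.

Set Implicit Arguments.
Unset Strict Implicit.
Unset Printing Implicit Defensive.

(* A finite simple graph is a symmetric irreflexive relation [e] on a finType *)
(* [T] of vertices.                                                           *)

Section Coalition.

Variables (T : finType) (e : rel T) (k : nat).

Definition k_dominating (S : {set T}) : bool :=
  [forall v in ~: S, k <= #|[set u in S | e v u]|].

Definition k_coalition (A B : {set T}) : bool :=
  [&& [disjoint A & B], ~~ k_dominating A, ~~ k_dominating B
    & k_dominating (A :|: B)].

(* [partition] excludes the empty block. *)
Definition k_coalition_partition (P : {set {set T}}) : bool :=
  partition P [set: T] &&
  [forall A in P, (k_dominating A && (#|A| == k))
                  || [exists B in P, (B != A) && k_coalition A B]].

(* The maximum is 0 when the graph has no k-coalition partition. *)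
Definition k_coalition_number : nat :=
  \max_(P : {set {set T}} | k_coalition_partition P) #|P|.

End Coalition.

Definition Kst (s t : nat) : rel ('I_s + 'I_t) := fun u v =>
  match u, v with
  | inl _, inr _ | inr _, inl _ => true
  | _, _ => false
  end.

Arguments Kst : clear implicits.

Lemma Kst_sym s t : symmetric (Kst s t).
Proof. by case=> ? [] ?. Qed.

Lemma Kst_irr s t : irreflexive (Kst s t).
Proof. by case. Qed.

(* Main.v *)
(* A set S dominates K_{s,t} iff each side is either contained in S or sees at
   least k vertices of S on the other side.

   Upper bounds for s > k.  If two blocks A, B cover one side, the remaining
   blocks lie on the other side Z, and a coalition involving one of them has at
   least k vertices in Z; counting Z gives |P| + k <= |Z| + 3.  Otherwise every
   coalition has at least k vertices on both sides.  Two disjoint coalitions use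
   up 4k vertices in four blocks, so |P| + 4k <= s + t + 4.  If there are no two
   disjoint coalitions, some block A is in coalition with all the others; A has
   fewer than k vertices on some side Z, so all the other blocks meet Z and
   |P| + k <= |Z| + 2.

   Lower bounds come from partitions into one or two large blocks and
   singletons: X \ x plus k - 1 vertices of Y, or two blocks with k and k - 1
   vertices on the two sides. *)
Require Import Defs.
From mathcomp Require Import all_boot zify.

Set Implicit Arguments.
Unset Strict Implicit.
Unset Printing Implicit Defensive.

(** * Counting the blocks of a partition *)

Section Partitions.

Variable T : finType.
Implicit Types (A B C D Z : {set T}) (P Q : {set {set T}}).

Lemma subset_of_card A n : n <= #|A| -> exists2 B : {set T}, B \subset A & #|B| = n.
Proof.
rewrite -bin_gt0 -cards_draws => /card_gt0P[B].
by rewrite inE => /andP[sBA /eqP]; exists B.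
Qed.

Lemma partitionU P Q D E :
    partition P D -> partition Q E -> [disjoint D & E] ->
  partition (P :|: Q) (D :|: E) /\ [disjoint P & Q].
Proof.
move=> pP pQ dDE; split; last first.
  rewrite disjoint_subset; apply/subsetP => A AP; rewrite inE /=.
  apply/negP => AQ; have /set0Pn[x xA] := partition_neq0 pP AP.
  have xD := subsetP (partitionS pP AP) _ xA.
  by have := disjointFr dDE xD; rewrite (subsetP (partitionS pQ AQ) _ xA).
apply/and3P; split.
- rewrite /cover bigcup_setU -!/(cover _).
  by rewrite (cover_partition pP) (cover_partition pQ).
- apply: trivIsetU; rewrite ?(cover_partition pP) ?(cover_partition pQ) //.
    exact: partition_trivIset pP.
  exact: partition_trivIset pQ.
- by rewrite inE (partition0 pP) (partition0 pQ).
Qed.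

Lemma partition_singletons D : partition [set [set x] | x in D] D.
Proof.
apply/and3P; split.
- apply/eqP/setP => x; apply/bigcupP/idP => [[_ /imsetP[y yD ->]]|xD].
    by rewrite inE => /eqP->.
  by exists [set x]; rewrite ?inE ?imset_f.
- apply/trivIsetP => _ _ /imsetP[x _ ->] /imsetP[y _ ->] neq_xy.
  by rewrite disjoints1 inE; apply: contraNneq neq_xy => ->.
- by apply/imsetP => -[x _ /setP/(_ x)]; rewrite !inE eqxx.
Qed.

Lemma partition1 A : A != set0 -> partition [set A] A.
Proof.
by move=> An0; rewrite /partition cover1 eqxx trivIset1 inE eq_sym An0.
Qed.

(** Counted inside [Z], the blocks of [Q] contribute the part of [Z] in their union, and every other
    block contributes at least one vertex. Repetitions in [Q] are harmless, since they only weaken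
    the bound. *)
Lemma leq_card_partition P D (Q : seq {set T}) Z :
    partition P D -> {subset Q <= P} -> Z \subset D ->
    {in P, forall C, C \notin Q -> C :&: Z != set0} ->
  #|P| + #|\bigcup_(A <- Q) A :&: Z| <= #|Z| + size Q.
Proof.
move=> pP sQP sZD meetZ; pose R := [set A in Q].
have sRP : R \subset P by apply/subsetP => A; rewrite inE => /sQP.
have sumZ (P' : {set {set T}}) : trivIset P' ->
    #|cover P' :&: Z| = \sum_(A in P') #|A :&: Z|.
  move=> tP'; rewrite -sum1_card.
  under eq_bigl do rewrite inE.
  rewrite big_trivIset_cond //; apply: eq_bigr => A _.
  by rewrite -sum1_card; apply: eq_bigl => x; rewrite inE.
have -> : \bigcup_(A <- Q) A = cover R.
  by rewrite bigcup_seq; apply: eq_bigl => A; rewrite inE.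
have tP := partition_trivIset pP.
have szQ : #|R| <= size Q by rewrite cardsE card_size.
have ZE : cover P :&: Z = Z by rewrite (cover_partition pP); apply/setIidPr.
have: #|Z| = \sum_(A in P) #|A :&: Z| by rewrite -sumZ // ZE.
rewrite (big_setID R) /= (setIidPr sRP) -sumZ ?(trivIsetS sRP) // => ->.
have le1 : #|P :\: R| <= \sum_(A in P :\: R) #|A :&: Z|.
  rewrite -sum1_card; apply: leq_sum => A; rewrite !inE => /andP[AQ AP].
  by rewrite card_gt0 meetZ.
have := cardsID R P; rewrite (setIidPr sRP) => <-.
by rewrite addnC -addnA leq_add2l addnC leq_add.
Qed.

End Partitions.

(** * Coalition partitions and the coalition number of an arbitrary graph *)

Section Coalitions.

Variables (T : finType) (e : rel T) (k : nat).
Implicit Types (A B C S : {set T}) (P Q : {set {set T}}).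

Local Notation dom := (k_dominating e k).

Lemma k_coalition_sym A B : k_coalition e k A B = k_coalition e k B A.
Proof.
by rewrite /k_coalition disjoint_sym setUC; case: (dom A); rewrite ?andbF.
Qed.

Lemma k_coalition_partition_leq P :
  k_coalition_partition e k P -> #|P| <= k_coalition_number e k.
Proof. exact: leq_bigmax_cond. Qed.

Lemma k_coalition_number_leq n :
    (forall P, k_coalition_partition e k P -> #|P| <= n) ->
  k_coalition_number e k <= n.
Proof. by move=> le_n; apply/bigmax_leqP. Qed.

Lemma k_coalition_partitionP P : k_coalition_partition e k P ->
  partition P setT /\
  {in P, forall A, dom A && (#|A| == k) \/
    exists2 B, B \in P & k_coalition e k A B}.
Proof.
case/andP => pP /forall_inP coalP; split=> // A /coalP/orP[|]; first by left.
by case/exists_inP => B BP /andP[_ AB]; right; exists B.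
Qed.

(* Extremal coalition partitions consist of at most two large blocks, each
   short of one vertex, together with singletons supplying that vertex. *)
Lemma k_coalition_number_geq Q :
    partition Q (cover Q) ->
    {in Q, forall A, ~~ dom A /\ exists2 x, x \notin cover Q & dom (x |: A)} ->
    (forall x, x \notin cover Q ->
      ~~ dom [set x] /\ exists2 A, A \in Q & dom (x |: A)) ->
  #|Q| + #|~: cover Q| <= k_coalition_number e k.
Proof.
move=> pQ largeQ smallQ.
have [|pU dU] := partitionU pQ (partition_singletons (~: cover Q)).
  by rewrite disjoints_subset setCK.
have coal x A : x \notin cover Q -> A \in Q -> dom (x |: A) ->
    k_coalition e k A [set x] && ([set x] != A).
  move=> xQ AQ dxA; have xA : x \notin A.
    by apply: contra xQ; apply/subsetP/bigcup_sup.
  rewrite /k_coalition disjoint_sym disjoints1 xA setUC dxA.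
  have [-> _] := largeQ _ AQ; have [-> _] := smallQ _ xQ => /=.
  by apply: contraNneq xA => <-; rewrite inE.
have <- : #|Q :|: [set [set x] | x in ~: cover Q]|
          = #|Q| + #|~: cover Q|.
  rewrite cardsU disjoint_setI0 // cards0 subn0 card_imset //; exact: set1_inj.
apply: k_coalition_partition_leq; rewrite /k_coalition_partition.
rewrite setUCr in pU; rewrite pU; apply/forall_inP => A; rewrite !inE.
case/orP => [AQ|/imsetP[x]].
  have [_ [x xQ dxA]] := largeQ _ AQ; apply/orP; right; apply/exists_inP.
  by exists [set x]; rewrite 1?andbC ?coal// !inE imset_f ?orbT// inE.
rewrite inE => xQ ->; have [_ [B BQ dxB]] := smallQ _ xQ.
apply/orP; right; apply/exists_inP; exists B; rewrite ?inE ?BQ//.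
by rewrite eq_sym k_coalition_sym andbC coal.
Qed.

End Coalitions.

(** * Domination in a complete bipartite graph *)

Section CompleteBipartite.

Variables (T : finType) (e : rel T) (k : nat).
Implicit Types (A B C D S X Y Z : {set T}) (P : {set {set T}}).

Local Notation dom := (k_dominating e k).
Local Notation coalition := (k_coalition e k).

(** The sides are arbitrary vertex sets, so that each lemma can also be applied with [X] and [Y]
    exchanged. *)
Definition complete_bipartite X Y :=
  ~: X = Y /\ forall u v, e u v = (u \in X) (+) (v \in X).

Lemma complete_bipartite_sym X Y :
  complete_bipartite X Y -> complete_bipartite Y X.
Proof.
case=> <- eE; split=> [|u v]; first by rewrite setCK.
by rewrite eE !inE; case: (u \in X); case: (v \in X).
Qed.

Lemma card_bipartite X Y S :
  complete_bipartite X Y -> #|S| = #|S :&: X| + #|S :&: Y|.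
Proof. by case=> <- _; rewrite -setDE cardsID. Qed.

(** The neighbors of [v] in [S] are the vertices of [S] on the opposite side. Hence all vertices of
    one side outside [S] impose the same condition, and a side contained in [S] imposes none. *)
Lemma k_dominatingE X Y S : complete_bipartite X Y ->
  dom S = ((X \subset S) || (k <= #|S :&: Y|)) &&
          ((Y \subset S) || (k <= #|S :&: X|)).
Proof.
case=> <- eE.
have nbr v : [set u in S | e v u] = S :&: (if v \in X then ~: X else X).
  by apply/setP => u; rewrite !inE eE; case: (v \in X); rewrite ?inE //= addbT.
have side (Z : {set T}) b : ((Z \subset S) || b) =
    [forall v in ~: S, (v \in Z) ==> b].
  case: b; first by rewrite orbT; apply/esym/forall_inP => v _; rewrite implybT.
  rewrite orbF; apply/subsetP/forall_inP => [sZS v|sZS v vZ].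
    by rewrite inE => vS; rewrite implybF; apply: contra vS; apply: sZS.
  by apply: contraLR vZ => vS; rewrite -implybF sZS // inE.
rewrite !side; apply/forall_inP/andP => [domS|[/forall_inP dX /forall_inP dY] v vS].
  by split; apply/forall_inP => v /domS; rewrite nbr ?inE;
    case: (v \in X) => //= ->.
rewrite nbr; have := dX v vS; have := dY v vS; rewrite !inE.
by case: (v \in X).
Qed.

Lemma k_dominating_sup X Y S : complete_bipartite X Y ->
  X \subset S -> k <= #|X| -> dom S.
Proof.
by move=> XY XS kX; rewrite (k_dominatingE _ XY) XS (setIidPr XS) kX orbT.
Qed.

Lemma coalitionP A B : coalition A B ->
  [/\ [disjoint A & B], ~~ dom A, ~~ dom B & dom (A :|: B)].
Proof. by case/and4P. Qed.

Lemma block_disjoint P A B :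
  partition P setT -> A \in P -> B \in P -> A != B -> [disjoint A & B].
Proof. by move=> pP; apply/trivIsetP/(partition_trivIset pP). Qed.

Lemma block_meets P A : partition P setT -> A \in P -> A :&: setT != set0.
Proof. by move=> pP AP; rewrite setIT (partition_neq0 pP). Qed.

Lemma disjoint_cover A B C X :
  [disjoint C & A] -> [disjoint C & B] -> X \subset A :|: B -> C :&: X = set0.
Proof.
move=> CA CB XAB; apply/eqP; rewrite setI_eq0 disjoint_sym.
apply: disjointWl XAB _; rewrite disjoint_sym disjoints_subset setCU subsetI.
by rewrite -!disjoints_subset CA.
Qed.

Lemma setU_sub_disjoint C D X : C :&: X = set0 -> X \subset C :|: D -> X \subset D.
Proof.
move=> CX0 /setIidPl XCD; apply/setIidPl.
by rewrite -[RHS]XCD setIUr [X :&: C]setIC CX0 set0U.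
Qed.

(** This is the count over the whole vertex set, which every block meets. The last hypothesis says
    that the blocks of [Q] together contain at least [n] vertices. *)
Lemma leq_card_blocks P (Q : seq {set T}) n :
    partition P setT -> {subset Q <= P} -> n + #|~: \bigcup_(A <- Q) A| <= #|T| ->
  #|P| + n <= #|T| + size Q.
Proof.
move=> pP sQP nQ.
have := leq_card_partition pP sQP (subsetT _) (fun C CP _ => block_meets pP CP).
rewrite setIT cardsT => le; apply: leq_trans le; rewrite leq_add2l.
by rewrite -(leq_add2r #|~: \bigcup_(A <- Q) A|) cardsC.
Qed.

(** * Upper bounds for s < k and s = k *)

Lemma card_four_covering_blocks X Y P A B C D : complete_bipartite X Y ->
    partition P setT -> A \in P -> B \in P -> C \in P -> D \in P ->
    X \subset A :|: B -> Y \subset C :|: D ->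
  #|P| <= 4.
Proof.
move=> XY pP AP BP CP DP XAB YCD; rewrite -(leq_add2l #|T|) addnC.
apply: (@leq_card_blocks P [:: A; B; C; D] #|T| pP).
  by move=> E; rewrite !inE => /or4P[] /eqP->.
suff -> : \bigcup_(A <- [:: A; B; C; D]) A = setT by rewrite setCT cards0 addn0.
apply/eqP; rewrite -subTset; case: XY => defY _; rewrite -(setUCr X) defY.
by rewrite !big_cons big_nil setU0 setUA setUSS.
Qed.

(* If two blocks cover [X], the others miss [X]. *)
Lemma card_leq2_of_cover X Y P A B : complete_bipartite X Y ->
    0 < #|X| -> k <= #|X| ->
    (forall S, dom S -> X \subset S \/ Y \subset S) ->
    k_coalition_partition e k P -> A \in P -> B \in P -> X \subset A :|: B ->
    {in P &, forall C D, ~~ (Y \subset C :|: D)} ->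
  #|P| <= 2.
Proof.
move=> XY X0 kX domE /k_coalition_partitionP[pP coalP] AP BP XAB nY.
suff PAB : P \subset [set A; B].
  by rewrite (leq_trans (subset_leq_card PAB)) // cards2; case: eqP.
apply/subsetP => C CP; rewrite !inE; apply/orP.
have [_|nCA] := eqVneq C A; first by left.
have [_|nCB] := eqVneq C B; first by right.
have CX0 : C :&: X = set0.
  by apply: (disjoint_cover _ _ XAB); apply: (block_disjoint pP).
(* Since [C] misses [X], it could dominate only by containing [Y], which is excluded. If [C] is in
   coalition with [D], their union contains [X], so [D] alone contains [X] and dominates. *)
case: (coalP C CP) => [/andP[/domE[XC|YC] _]|[D DP /coalitionP[_ _ nD]]].
- by move: X0; rewrite -(setIidPr XC) CX0 cards0.
- by have := nY C C CP CP; rewrite setUid YC.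
case/domE => [XCD|YCD]; last by have := nY C D CP DP; rewrite YCD.
by rewrite (k_dominating_sup XY (setU_sub_disjoint CX0 XCD)) in nD.
Qed.

(** When [X] has exactly [k] vertices, seeing [k] of them means containing [X], so every dominating
    set contains a whole side. The cases are which sides are covered by two blocks: both give at
    most four blocks, exactly one gives at most two. *)
Lemma card_leq4_of_eq X Y P : complete_bipartite X Y ->
    0 < k -> #|X| = k -> k <= #|Y| -> k_coalition_partition e k P -> #|P| <= 4.
Proof.
move=> XY k0 cX kY coalP; have [pP blockP] := k_coalition_partitionP coalP.
have domE S : dom S -> X \subset S \/ Y \subset S.
  rewrite (k_dominatingE _ XY) => /andP[_ /orP[YS|kS]]; first by right.
  left; apply/setIidPr/eqP; by rewrite eqEcard subsetIr cX.
have domE' S : dom S -> Y \subset S \/ X \subset S by case/domE; [right|left].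
have YX := complete_bipartite_sym XY.
pose covered (Z : {set T}) := [exists A in P, exists B in P, Z \subset A :|: B].
have ncov Z : ~~ covered Z -> {in P &, forall C D, ~~ (Z \subset C :|: D)}.
  move=> nZ C D CP DP; apply: contra nZ => ZCD; apply/exists_inP; exists C => //.
  by apply/exists_inP; exists D.
have [/exists_inP[A AP /exists_inP[B BP XAB]]|nX] := boolP (covered X); last first.
  have [/exists_inP[A AP /exists_inP[B BP YAB]]|nY] := boolP (covered Y).
    by rewrite (leq_trans (card_leq2_of_cover YX _ _ domE' coalP AP BP YAB _)) //;
      [lia|apply: ncov].
  (* If neither side is covered by two blocks, no block dominates or has a partner, so there are no
     blocks. *)
  have [->|[A AP]] := set_0Vmem P; first by rewrite cards0.
  have [/andP[dA _]|[B BP /coalitionP[_ _ _ dAB]]] := blockP _ AP.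
    have := domE A dA; have := ncov _ nX _ _ AP AP; have := ncov _ nY _ _ AP AP.
    by rewrite setUid => /negPf-> /negPf-> [].
  have := domE _ dAB; have := ncov _ nX _ _ AP BP; have := ncov _ nY _ _ AP BP.
  by move=> /negPf-> /negPf-> [].
have [/exists_inP[C CP /exists_inP[D DP YCD]]|nY] := boolP (covered Y); last first.
  by rewrite (leq_trans (card_leq2_of_cover XY _ _ domE coalP AP BP XAB _)) ?cX //;
    apply: ncov.
exact: (card_four_covering_blocks XY pP _ _ _ _ XAB YCD).
Qed.

(** A vertex of [Y] has fewer than [k] neighbors, so every dominating set contains [Y]. Three blocks
    then lead to a contradiction. *)
Lemma card_leq2_of_lt X Y P : complete_bipartite X Y ->
    0 < #|Y| -> #|X| < k -> k_coalition_partition e k P -> #|P| <= 2.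
Proof.
move=> XY Y0 Xk /k_coalition_partitionP[pP blockP].
have domY S : dom S -> Y \subset S.
  rewrite (k_dominatingE _ XY) => /andP[_ /orP[//|kS]].
  by have := subset_leq_card (subsetIr S X); lia.
have [|lt2] := leqP #|P| 2 => //.
(* If [A] dominates, it contains [Y] and any other block [C] misses [Y]. A partner of [C] would have
   to contain [Y], hence be [A], but a member of a coalition does not dominate. *)
have ndom A : A \in P -> ~~ dom A.
  move=> AP; apply/negP => dA; have YA := domY _ dA.
  have /card_gt0P[C] : 0 < #|P :\ A|.
    by move: lt2; rewrite (cardsD1 A) AP; case: #|_|.
  rewrite !inE => /andP[nCA CP].
  have CY0 : C :&: Y = set0.
    have dCA := block_disjoint pP CP AP nCA.
    by apply: (disjoint_cover dCA dCA); rewrite setUid.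
  have [/andP[/domY YC _]|[D DP /coalitionP[_ _ nD /domY YCD]]] := blockP _ CP.
    by move: Y0; rewrite -(setIidPr YC) CY0 cards0.
  have YD := setU_sub_disjoint CY0 YCD.
  have [eDA|nDA] := eqVneq D A; first by rewrite eDA dA in nD.
  have DY0 : D :&: Y = set0.
    have dDA := block_disjoint pP DP AP nDA.
    by apply: (disjoint_cover dDA dDA); rewrite setUid.
  by move: Y0; rewrite -(setIidPr YD) DY0 cards0.
have coalP A : A \in P -> exists2 B, B \in P & coalition A B.
  move=> AP; case: (blockP A AP) => [/andP[dA _]|[B BP AB]]; last by exists B.
  by case/negP: (ndom A AP).
have /card_gt0P[A AP] : 0 < #|P| by lia.
have [B BP /coalitionP[_ _ _ dAB]] := coalP A AP.
have /card_gt0P[C] : 0 < #|P :\ A :\ B|.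
  move: lt2; rewrite (cardsD1 A) (cardsD1 B) AP.
  by case: (B \in _); case: #|_|.
rewrite !inE => /and3P[nCB nCA CP].
have dCA := block_disjoint pP CP AP nCA.
have dCB := block_disjoint pP CP BP nCB.
have CY0 := disjoint_cover dCA dCB (domY _ dAB).
have [D DP /coalitionP[_ _ nD /domY YCD]] := coalP C CP.
have YD := setU_sub_disjoint CY0 YCD.
(* [D] contains [Y] without dominating, so [Y] is smaller than [k] too. Then [A :|: B] dominates
   only if it also contains [X], and no vertex is left for [C]. *)
have Yk : #|Y| < k.
  rewrite ltnNge; apply: contra nD.
  exact: (k_dominating_sup (complete_bipartite_sym XY)).
have XAB : X \subset A :|: B.
  move: dAB; rewrite (k_dominatingE _ XY) => /andP[/orP[//|kAB] _].
  by move: Yk; rewrite ltnNge (leq_trans kAB) // subset_leq_card ?subsetIr.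
have := partition_neq0 pP CP.
by rewrite -cards_eq0 (card_bipartite C XY) CY0 (disjoint_cover dCA dCB XAB) cards0.
Qed.

(** * Upper bounds for s > k *)

(** A dominating set of [k] vertices contains neither side, so it would need [k] vertices on each
    side. Thus dominating blocks of size [k] do not occur. *)
Lemma exists_coalition X Y P : complete_bipartite X Y -> 0 < k ->
    k < #|X| -> k < #|Y| -> k_coalition_partition e k P ->
  {in P, forall A, exists2 B, B \in P & coalition A B}.
Proof.
move=> XY k0 kX kY /k_coalition_partitionP[_ blockP] A AP.
have [/andP[dA /eqP cA]|[B BP AB]] := blockP A AP; last by exists B.
have leA Z : Z \subset A -> #|Z| <= k by rewrite -cA; apply: subset_leq_card.
move: dA (card_bipartite A XY); rewrite (k_dominatingE _ XY) cA.
by case/andP => /orP[/leA ?|?] /orP[/leA ?|?]; lia.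
Qed.

Lemma leq_card_cover X Y P A B : complete_bipartite X Y ->
    0 < k -> k < #|X| -> k < #|Y| -> k_coalition_partition e k P ->
    A \in P -> B \in P -> X \subset A :|: B ->
  #|P| + k <= #|Y| + 3.
Proof.
move=> XY k0 kX kY coalP AP BP XAB.
have [pP _] := k_coalition_partitionP coalP.
have {}coalP := exists_coalition XY k0 kX kY coalP.
have missX C : C \in P -> C != A -> C != B -> C :&: X = set0.
  move=> CP nCA nCB.
  by apply: (disjoint_cover _ _ XAB); apply: (block_disjoint pP).
have [sPAB|/subsetPn[C CP]] := boolP (P \subset [set A; B]).
  by have := subset_leq_card sPAB; rewrite cards2; case: (A != B); lia.
rewrite !inE negb_or => /andP[nCA nCB].
have CX0 := missX C CP nCA nCB.
have [D DP /coalitionP[_ _ nD dCD]] := coalP C CP.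
(* Otherwise [C :|: D] would contain [X]; as [C] misses [X], the block [D] would contain it and
   dominate alone. *)
have kCD : k <= #|(C :|: D) :&: Y|.
  move: dCD; rewrite (k_dominatingE _ XY) => /andP[/orP[XCD|//] _].
  by rewrite (k_dominating_sup XY (setU_sub_disjoint CX0 XCD)) ?(ltnW kX) in nD.
have [DAB|] := boolP (D \in [:: A; B]).
  have sQP : {subset [:: A; B; C] <= P}.
    by move=> E; rewrite !inE => /or3P[] /eqP->.
  have sCD : C :|: D \subset \bigcup_(E <- [:: A; B; C]) E.
    rewrite !big_cons big_nil setU0 setUA setUC setUSS //.
    by move: DAB; rewrite !inE => /orP[] /eqP ->; rewrite ?subsetUl ?subsetUr.
  have := leq_card_partition pP sQP (subsetT Y).
  have := subset_leq_card (setSI Y sCD); set m := #|\bigcup_(_ <- _) _ :&: _|.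
  move=> lem lePm; apply: leq_trans (lePm _).
    by rewrite leq_add2l (leq_trans kCD).
  move=> E EP; rewrite !inE !negb_or => /and3P[nEA nEB _].
  have := partition_neq0 pP EP.
  by rewrite -!cards_eq0 (card_bipartite E XY) missX // cards0.
rewrite !inE negb_or => /andP[nDA nDB].
(* Now [C] and [D] both miss [X], so a vertex of [Y] outside them would see none of their vertices.
   Four blocks then cover everything, and [k < #|Y|] makes the bound 4 sufficient. *)
have YCD : Y \subset C :|: D.
  move: dCD; rewrite (k_dominatingE _ XY) => /andP[_ /orP[//|]].
  by rewrite setIUl CX0 missX // setU0 cards0 leqNgt k0.
suff: #|P| <= 4 by move: kY; clear; lia.
exact: (card_four_covering_blocks XY pP _ _ _ _ XAB YCD).
Qed.

(** Each block other than [A] must meet [X] to raise the count to [k]. Counting [X] with [A] and one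
    such block [B] set apart gives the first alternative; the second is the case where [B] does not
    exist. *)
Lemma leq_card_star P A X :
    partition P setT -> A \in P -> #|A :&: X| < k ->
    (forall B, B \in P -> B != A -> k <= #|(A :|: B) :&: X|) ->
  #|P| + k <= #|X| + 2 \/ #|P| <= 1.
Proof.
move=> pP AP Ak starA.
have [sPA|/subsetPn[B BP]] := boolP (P \subset [set A]).
  by right; have := subset_leq_card sPA; rewrite cards1.
rewrite inE => nBA; left.
have sQP : {subset [:: A; B] <= P} by move=> E; rewrite !inE => /orP[] /eqP->.
have := leq_card_partition pP sQP (subsetT X).
rewrite !big_cons big_nil setU0 => le.
apply: leq_trans (le _); first by rewrite leq_add2l starA.
move=> E EP; rewrite !inE negb_or => /andP[nEA nEB]; apply: contraTneq Ak => EX0.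
by rewrite -leqNgt; have := starA E EP nEA; rewrite setIUl EX0 setU0.
Qed.

Lemma leq_card_large X Y P : complete_bipartite X Y ->
    0 < k -> k < #|X| -> #|X| <= #|Y| -> k_coalition_partition e k P ->
  #|P| + k <= #|Y| + 3 \/ #|P| + 4 * k <= #|X| + #|Y| + 4.
Proof.
move=> XY k0 kX leXY coalP; have kY := leq_trans kX leXY.
have YX := complete_bipartite_sym XY.
have [/exists_inP[A AP /exists_inP[B BP XAB]]|nX] :=
    boolP [exists A in P, exists B in P, X \subset A :|: B].
  by left; apply: (leq_card_cover XY _ _ _ _ AP BP).
have [/exists_inP[A AP /exists_inP[B BP YAB]]|nY] :=
    boolP [exists A in P, exists B in P, Y \subset A :|: B].
  by left; have := leq_card_cover YX k0 kY kX coalP AP BP YAB; lia.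
have [pP _] := k_coalition_partitionP coalP.
have {}coalP := exists_coalition XY k0 kX kY coalP.
have sumk A B : A \in P -> B \in P -> coalition A B ->
    k <= #|(A :|: B) :&: X| /\ k <= #|(A :|: B) :&: Y|.
  move=> AP BP /coalitionP[_ _ _]; rewrite (k_dominatingE _ XY).
  have /negPf-> : ~~ (X \subset A :|: B).
    apply: contra nX => XAB; apply/exists_inP; exists A => //.
    by apply/exists_inP; exists B.
  have /negPf-> : ~~ (Y \subset A :|: B).
    apply: contra nY => YAB; apply/exists_inP; exists A => //.
    by apply/exists_inP; exists B.
  by case/andP.
have [->|[A0 A0P]] := set_0Vmem P; first by left; rewrite cards0; lia.
have [/exists_inP[A AP /forall_inP starA]|nstar] :=
    boolP [exists A in P, forall B in P, (B != A) ==> coalition A B].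
  left; have sumA B : B \in P -> B != A ->
      k <= #|(A :|: B) :&: X| /\ k <= #|(A :|: B) :&: Y|.
    by move=> BP nBA; apply: sumk => //; apply: implyP nBA; apply: starA.
  have [B BP /coalitionP[_ nA _ _]] := coalP A AP.
  have [kAX|AXk] := leqP k #|A :&: X|; last first.
    by have [] := leq_card_star pP AP AXk (fun E EP nEA => (sumA E EP nEA).1);
      move: kY leXY; clear; lia.
  (* Not dominating, [A] cannot have [k] vertices on both sides, so the star argument applies on at
     least one side. *)
  have AYk : #|A :&: Y| < k.
    rewrite ltnNge; apply: contra nA => kAY.
    by rewrite (k_dominatingE _ XY) kAX kAY !orbT.
  by have [] := leq_card_star pP AP AYk (fun E EP nEA => (sumA E EP nEA).2);
    move: kY; clear; lia.
suff [Q [szQ sQP cQ]] : exists Q : seq {set T},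
    [/\ size Q = 4, {subset Q <= P} & 4 * k <= #|\bigcup_(A <- Q) A|].
  right; have := @leq_card_blocks P Q (4 * k) pP sQP.
  have <- : #|T| = #|X| + #|Y|.
    by rewrite -cardsT (card_bipartite _ XY) !setTI.
  by rewrite szQ; apply; rewrite -(cardsC (\bigcup_(A <- Q) A)) leq_add2r.
(* Two coalitions without a common block each have at least [k] vertices on either side, hence at
   least [4 * k] in all. *)
have card2 A B C D : A \in P -> B \in P -> C \in P -> D \in P ->
    coalition A B -> coalition C D -> C \notin [:: A; B] -> D \notin [:: A; B] ->
  exists Q : seq {set T},
    [/\ size Q = 4, {subset Q <= P} & 4 * k <= #|\bigcup_(A <- Q) A|].
  move=> AP BP CP DP AB CD; rewrite !inE !negb_or.
  move=> /andP[CA CB] /andP[DA DB]; exists [:: A; B; C; D]; split=> //.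
    by move=> E; rewrite !inE => /or4P[] /eqP->.
  rewrite !big_cons big_nil setU0 setUA cardsU disjoint_setI0.
    have [] := sumk A B AP BP AB; have [] := sumk C D CP DP CD.
    rewrite cards0 !(card_bipartite (_ :|: _) XY); clear; lia.
  rewrite disjoint_sym disjoints_subset subUset !setCU !subsetI.
  by rewrite -!disjoints_subset !(block_disjoint pP).
(* Here [A] has two partners [B] and [C]. Some [E] is not in coalition with [A], so its partner [F]
   is not [A]. The disjoint pairs are [C], [A] and [E], [F] if [F] is [B], and [A], [B] and [E], [F]
   otherwise. *)
have star1 A B C : A \in P -> B \in P -> C \in P -> 
    coalition A B -> coalition C A -> C != B ->
  exists Q : seq {set T},
    [/\ size Q = 4, {subset Q <= P} & 4 * k <= #|\bigcup_(A <- Q) A|].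
  move=> AP BP CP AB CA nCB.
  have /forall_inPn[E EP] := exists_inPn nstar A AP.
  rewrite negb_imply => /andP[nEA nAE].
  have nEB : E != B by apply: contraNneq nAE => ->.
  have nEC : E != C by apply: contraNneq nAE => ->; rewrite k_coalition_sym.
  have [F FP EF] := coalP E EP.
  have nFA : F != A by apply: contraNneq nAE => <-; rewrite k_coalition_sym.
  have [eFB|nFB] := eqVneq F B.
    apply: (card2 C A E F) => //; rewrite !inE negb_or ?nEC ?nEA //.
    by rewrite nFA andbT eFB eq_sym.
  by apply: (card2 A B E F) => //; rewrite !inE negb_or ?nEA ?nEB ?nFA.
have [B0 B0P AB0] := coalP A0 A0P.
(* With no block besides [A0] and [B0], the block [A0] would be in coalition with all the others. *)
have /subsetPn[C CP] : ~~ (P \subset [set A0; B0]).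
  apply: contra nstar => /subsetP sP; apply/exists_inP; exists A0 => //.
  apply/forall_inP => E /sP; rewrite !inE => /orP[|] /eqP->; first by rewrite eqxx.
  by rewrite AB0 implybT.
rewrite !inE negb_or => /andP[nCA nCB].
have [D DP CD] := coalP C CP.
have [eDA|nDA] := eqVneq D A0.
  by apply: (star1 A0 B0 C) => //; rewrite -eDA.
have [eDB|nDB] := eqVneq D B0.
  by apply: (star1 B0 A0 C) => //; rewrite -?eDB // eDB k_coalition_sym.
by apply: (card2 A0 B0 C D) => //; rewrite !inE negb_or ?nCA ?nDA.
Qed.

(** * Lower bounds by explicit partitions *)

Lemma not_k_dominating X Y S x : complete_bipartite X Y ->
  x \in X -> x \notin S -> #|S :&: Y| < k -> ~~ dom S.
Proof.
move=> XY xX xS Sk; rewrite (k_dominatingE _ XY) negb_and negb_or -ltnNge Sk andbT.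
by apply/orP; left; apply: contra xS => /subsetP; apply.
Qed.

Lemma k_dominatingU1 X Y S y : complete_bipartite X Y ->
  y \in Y -> y \notin S -> k <= #|S :&: X| -> k <= #|S :&: Y|.+1 -> dom (y |: S).
Proof.
move=> XY yY yS kX kY; rewrite (k_dominatingE _ XY) !setIUl.
have -> : [set y] :&: Y = [set y] by apply/setIidPl; rewrite sub1set.
rewrite cardsU1 inE (negPf yS) add1n kY orbT /=.
by rewrite (leq_trans kX) ?orbT // subset_leq_card ?subsetUr.
Qed.

Lemma set1_not_k_dominating X Y x : complete_bipartite X Y ->
  1 < k -> 1 < #|X| -> ~~ dom [set x].
Proof.
move=> XY k1 /card_gt1P[y [z [yX zX nyz]]].
have sing S : #|[set x] :&: S| < k.
  by rewrite (leq_ltn_trans _ k1) // -(cards1 x) subset_leq_card ?subsetIl.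
have [eyx|nyx] := eqVneq y x.
  by apply: (not_k_dominating XY zX); rewrite // inE -eyx eq_sym.
by apply: (not_k_dominating XY yX); rewrite // inE.
Qed.

Lemma bipartite_setIU X Y A B : complete_bipartite X Y ->
  A \subset X -> B \subset Y -> (A :|: B) :&: X = A /\ (A :|: B) :&: Y = B.
Proof.
case=> <- _ AX BY; rewrite !setIUl (setIidPl AX) (setIidPl BY).
have -> : B :&: X = set0 by apply/eqP; rewrite setI_eq0 disjoints_subset.
have -> : A :&: ~: X = set0.
  by apply/eqP; rewrite setI_eq0 disjoint_sym disjoints_subset setCS.
by rewrite setU0 set0U.
Qed.

Lemma k_coalition_number_one_large A : A != set0 -> A != setT -> ~~ dom A ->
    (forall x, x \notin A -> ~~ dom [set x] /\ dom (x |: A)) ->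
  1 + #|~: A| <= k_coalition_number e k.
Proof.
move=> An0 AnT nA smallA; rewrite -(cards1 A).
have {2}<- : cover [set A] = A by rewrite cover1.
apply: k_coalition_number_geq; rewrite cover1; first exact: partition1.
  move=> _ /set1P->; split=> //.
  (* The large block needs a partner as well: any vertex outside it serves. *)
  have /subsetPn[x _ xA] : ~~ (setT \subset A) by rewrite subTset.
  by exists x => //; have [] := smallA x xA.
move=> x xA; have [nx dx] := smallA x xA; split=> //.
by exists A; rewrite ?inE.
Qed.

Lemma k_coalition_number_two_large A B :
    A != set0 -> B != set0 -> [disjoint A & B] ->
    ~~ dom A -> ~~ dom B ->
    (exists2 x, x \notin A :|: B & dom (x |: A)) ->
    (exists2 x, x \notin A :|: B & dom (x |: B)) ->
    (forall x, x \notin A :|: B ->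
      ~~ dom [set x] /\ (dom (x |: A) \/ dom (x |: B))) ->
  2 + #|~: (A :|: B)| <= k_coalition_number e k.
Proof.
move=> An0 Bn0 dAB nA nB xA xB small.
have [pAB _] := partitionU (partition1 An0) (partition1 Bn0) dAB.
have nAB : A != B.
  by apply: contraNneq An0 => eAB; move: dAB; rewrite -eAB -setI_eq0 setIid.
have <- : #|[set A; B]| = 2 by rewrite cards2 nAB.
have covAB := cover_partition pAB.
rewrite -covAB; apply: k_coalition_number_geq; rewrite covAB //.
  by move=> C; rewrite !inE => /orP[] /eqP->.
move=> x /small[nx dx]; split=> //.
by case: dx; [exists A|exists B]; rewrite // !inE eqxx ?orbT.
Qed.

(** The blocks are a single vertex [y] of [Y] and its complement, which does not dominate because
    [y] has only [#|X| < k] neighbors. *)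
Lemma k_coalition_number_geq2 X Y : complete_bipartite X Y ->
  1 < k -> 0 < #|X| -> 0 < #|Y| -> #|X| < k -> 2 <= k_coalition_number e k.
Proof.
move=> XY k1 /card_gt0P[x xX] /card_gt0P[y yY] Xk.
have YX := complete_bipartite_sym XY.
have nyx : x != y.
  by apply: contraTneq yY => <-; case: XY => <- _; rewrite inE negbK.
rewrite -[2]/(1 + 1) -{2}(cards1 y) -[[set y]]setCK.
apply: k_coalition_number_one_large.
- by apply/set0Pn; exists x; rewrite !inE.
- by apply/negP => /eqP/setP/(_ y); rewrite !inE eqxx.
- apply: (not_k_dominating YX yY); first by rewrite !inE eqxx.
  by rewrite (leq_ltn_trans _ Xk) // subset_leq_card ?subsetIr.
move=> z; rewrite !inE negbK => /eqP->; split.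
  apply: (not_k_dominating XY xX); first by rewrite inE.
  by rewrite (leq_ltn_trans _ k1) // -(cards1 y) subset_leq_card ?subsetIl.
by rewrite setUCr; apply/forall_inP => v; rewrite setCT inE.
Qed.

(** The blocks are [X :\ x], [Y :\ y] and the singletons of [x] and [y]: each punctured side is
    completed by its own missing vertex, since both sides have at least [k] vertices. *)
Lemma k_coalition_number_geq4 X Y : complete_bipartite X Y ->
  1 < k -> #|X| = k -> k <= #|Y| -> 4 <= k_coalition_number e k.
Proof.
move=> XY k1 Xk kY; have YX := complete_bipartite_sym XY.
have inY v : (v \in Y) = (v \notin X) by case: XY => <- _; rewrite inE.
have X1 : 1 < #|X| by rewrite Xk.
have Y1 : 1 < #|Y| by apply: leq_trans kY.
have [x xX] : exists x, x \in X by apply/card_gt0P; apply: ltnW.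
have [y yY] : exists y, y \in Y by apply/card_gt0P; apply: ltnW.
have sides v : v \notin (X :\ x) :|: (Y :\ y) -> (v == x) || (v == y).
  by rewrite !inE inY; case: (v == x) (v == y) (v \in X) => [] [] [].
have nyx : x != y by apply: contraTneq yY => <-; rewrite inY negbK.
have cR : #|~: ((X :\ x) :|: (Y :\ y))| = 2.
  rewrite -(_ : #|[set x; y]| = 2); last by rewrite cards2 nyx.
  apply/eq_card => v; rewrite !inE.
  apply/idP/idP => [nv|]; first by apply: sides; rewrite !inE.
  case/orP => /eqP->; rewrite eqxx /=.
    by rewrite inY xX andbF.
  by rewrite orbF; move: yY; rewrite inY => /negPf->; rewrite andbF.
rewrite -[4]/(2 + 2) -{2}cR.
have [XI YI] := bipartite_setIU XY (subsetDl X [set x]) (subsetDl Y [set y]).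
have dX : dom (x |: (X :\ x)) by rewrite setD1K // (k_dominating_sup XY) ?Xk.
have dY : dom (y |: (Y :\ y)) by rewrite setD1K // (k_dominating_sup YX).
apply: k_coalition_number_two_large.
- by rewrite -card_gt0; move: X1; rewrite (cardsD1 x) xX.
- by rewrite -card_gt0; move: Y1; rewrite (cardsD1 y) yY.
- rewrite disjoints_subset; apply/subsetP => v; rewrite !inE inY.
  by case: (v \in X); rewrite ?andbF.
- apply: (not_k_dominating XY xX); first by rewrite !inE eqxx.
  rewrite (_ : _ :&: _ = set0) ?cards0 ?(ltnW k1) //.
  by apply/setP => v; rewrite !inE inY; case: (v \in X); rewrite ?andbF.
- apply: (not_k_dominating YX yY); first by rewrite !inE eqxx.
  rewrite (_ : _ :&: _ = set0) ?cards0 ?(ltnW k1) //.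
  by apply/setP => v; rewrite !inE inY; case: (v \in X); rewrite ?andbF.
- by exists x; rewrite // !inE eqxx inY xX andbF.
- exists y; rewrite // !inE eqxx orbF; move: yY; rewrite inY => /negPf->.
  by rewrite andbF.
move=> v /sides v_xy; split; first exact: (set1_not_k_dominating _ XY).
by case/orP: v_xy => /eqP->; [left|right].
Qed.

(** The large block is [X :\ x] with [k - 1] vertices of [Y]. Adding [x] completes [X]; adding a
    further vertex of [Y] gives [k] vertices in [Y] beside the [#|X| - 1 >= k] in [X]. There are
    [#|Y| - k + 2] singletons. *)
Lemma k_coalition_number_geq_right X Y : complete_bipartite X Y ->
  1 < k -> k < #|X| -> k <= #|Y| -> #|Y| + 3 <= k_coalition_number e k + k.
Proof.
move=> XY k1 kX kY; have YX := complete_bipartite_sym XY.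
have inY v : (v \in Y) = (v \notin X) by case: XY => <- _; rewrite inE.
have [x xX] : exists x, x \in X by apply/card_gt0P; apply: leq_ltn_trans kX.
have [B BY cB] := subset_of_card (leq_trans (leq_pred k) kY).
have [] := bipartite_setIU XY (subsetDl X [set x]) BY.
set A := _ :|: B => AX AY.
have cX : #|A :&: X|.+1 = #|X| by rewrite AX [RHS](cardsD1 x) xX.
have cY : #|A :&: Y|.+1 = k by rewrite AY cB prednK // ltnW.
have cT : #|A| + #|~: A| = #|X| + #|Y|.
  by rewrite cardsC -cardsT (card_bipartite _ XY) !setTI.
have xA : x \notin A by rewrite -[x \in A]andbT -xX -in_setI AX !inE eqxx.
suff: 1 + #|~: A| <= k_coalition_number e k.
  move: cT; rewrite (card_bipartite A XY); move: cX cY k1.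
  by move: #|A :&: X| #|A :&: Y| #|~: A| #|X| #|Y|; clear; lia.
have dx : dom (x |: A).
  apply: (k_dominating_sup XY); last exact: ltnW.
  by rewrite setUA setD1K ?subsetUl.
apply: k_coalition_number_one_large.
- apply/negP => /eqP A0; move: cX kX; rewrite A0 set0I cards0 => <-.
  by rewrite ltnS leqNgt ltnW.
- by apply: contraNneq xA => ->.
- by apply: (not_k_dominating XY xX xA); rewrite -cY.
move=> v vA; split; first exact: (set1_not_k_dominating _ XY k1 (ltn_trans k1 kX)).
have [vX|vX] := boolP (v \in X).
  suff -> : v = x by [].
  by apply: contraNeq vA => nvx; rewrite !inE nvx vX.
by apply: (k_dominatingU1 XY); rewrite ?inY ?cY //; rewrite -ltnS cX.
Qed.

Lemma disjoint_subsets_of_card X m n : m + n <= #|X| ->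
  exists A B, [/\ A \subset X, B \subset X, [disjoint A & B], #|A| = m & #|B| = n].
Proof.
move=> le_mn; have [A AX cA] := subset_of_card (leq_trans (leq_addr n m) le_mn).
have [|B] := @subset_of_card _ (X :\: A) n.
  by rewrite cardsD (setIidPr AX) cA leq_subRL ?(leq_trans (leq_addr n m)).
rewrite subsetD => /andP[BX BA] cB; exists A, B; split=> //.
by rewrite disjoint_sym.
Qed.

(** The block [A] has [k] vertices in [X] and [k - 1] in [Y], and [B] the reverse. Any further
    vertex of [Y] completes [A], any further vertex of [X] completes [B], and [4 * k - 2] vertices
    lie in the two large blocks. *)
Lemma k_coalition_number_geq_both X Y : complete_bipartite X Y ->
    1 < k -> 2 * k <= #|X| -> 2 * k <= #|Y| ->
  #|X| + #|Y| + 4 <= k_coalition_number e k + 4 * k.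
Proof.
move=> XY k1 kX kY; have YX := complete_bipartite_sym XY.
have inY v : (v \in Y) = (v \notin X) by case: XY => <- _; rewrite inE.
have X1 : 1 < #|X| by apply: leq_trans kX; lia.
have [|A1 [B1 [A1X B1X dX cA1 cB1]]] := @disjoint_subsets_of_card X k k.-1.
  by apply: leq_trans kX; lia.
have [|B2 [A2 [B2Y A2Y dY cB2 cA2]]] := @disjoint_subsets_of_card Y k k.-1.
  by apply: leq_trans kY; lia.
have [] := bipartite_setIU XY A1X A2Y; set A := A1 :|: A2 => AX AY.
have [] := bipartite_setIU XY B1X B2Y; set B := B1 :|: B2 => BX BY.
clearbody A B.
have dAB : [disjoint A & B].
  rewrite -setI_eq0 -cards_eq0 (card_bipartite _ XY).
  rewrite [A :&: B :&: X]setIIl [A :&: B :&: Y]setIIl AX AY BX BY.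
  by rewrite (disjoint_setI0 dX) [A2 :&: _]setIC (disjoint_setI0 dY) cards0.
have cAB : #|A :|: B| = 4 * k - 2.
  rewrite cardsU disjoint_setI0 // cards0.
  rewrite (card_bipartite A XY) (card_bipartite B XY).
  by rewrite AX AY BX BY cA1 cA2 cB1 cB2; clear; lia.
have cT : #|A :|: B| + #|~: (A :|: B)| = #|X| + #|Y|.
  by rewrite cardsC -cardsT (card_bipartite _ XY) !setTI.
(* The large blocks use [2 * k - 1] vertices of each side, so each side keeps a vertex for a
   singleton. *)
have outside Z : 2 * k <= #|Z| -> #|A :&: Z| + #|B :&: Z| = (2 * k).-1 ->
    exists2 x, x \in Z & x \notin A :|: B.
  move=> kZ cZ; apply/subsetPn/negP => /setIidPr ZAB.
  move: kZ; rewrite -ZAB setIUl leqNgt => /negP; apply.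
  by rewrite (leq_ltn_trans (leq_card_setU _ _).1) // cZ; move: k1; clear; lia.
have [|x xX xAB] := outside X kX.
  by rewrite AX BX cA1 cB1; move: k1; clear; lia.
have [|y yY yAB] := outside Y kY.
  by rewrite AY BY cA2 cB2; move: k1; clear; lia.
suff: 2 + #|~: (A :|: B)| <= k_coalition_number e k.
  by move: cT; rewrite cAB; move: k1; clear; lia.
have k1k : k.-1.+1 = k by rewrite prednK // ltnW.
have dA v : v \in Y -> v \notin A :|: B -> dom (v |: A).
  rewrite inE negb_or => vY /andP[vA _].
  by apply: (k_dominatingU1 XY); rewrite ?AX ?AY ?cA1 ?cA2 ?k1k.
have dB v : v \in X -> v \notin A :|: B -> dom (v |: B).
  rewrite inE negb_or => vX /andP[_ vB].
  by apply: (k_dominatingU1 YX); rewrite ?BX ?BY ?cB1 ?cB2 ?k1k.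
move: (xAB) (yAB); rewrite !inE !negb_or => /andP[xA xB] /andP[yA yB].
apply: k_coalition_number_two_large => //.
- rewrite -card_gt0 (card_bipartite _ XY) AX cA1; move: k1; clear; lia.
- rewrite -card_gt0 (card_bipartite _ XY) BY cB2; move: k1; clear; lia.
- by apply: (not_k_dominating XY xX xA); rewrite AY cA2 k1k.
- by apply: (not_k_dominating YX yY yB); rewrite BX cB1 k1k.
- by exists y; rewrite ?dA.
- by exists x; rewrite ?dB.
move=> v vAB; split; first exact: (set1_not_k_dominating _ XY).
by have [vX|vX] := boolP (v \in X); [right; apply: dB|left; apply: dA; rewrite ?inY].
Qed.

End CompleteBipartite.

(** * The sides of the concrete graph, and the four cases *)

Section Kst.

Variables s t : nat.

Definition left_part : {set 'I_s + 'I_t} := [set inl i | i : 'I_s].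
Definition right_part : {set 'I_s + 'I_t} := [set inr j | j : 'I_t].

Lemma card_left_part : #|left_part| = s.
Proof. by rewrite card_imset ?card_ord // => i j []. Qed.

Lemma card_right_part : #|right_part| = t.
Proof. by rewrite card_imset ?card_ord // => i j []. Qed.

Lemma Kst_complete_bipartite : complete_bipartite (Kst s t) left_part right_part.
Proof.
have inl_left i : inl i \in left_part by apply: imset_f.
have inr_left j : (inr j \in left_part) = false by apply/imsetP => -[].
split=> [|u v].
  apply/setP => -[i|j]; rewrite !inE; last by rewrite inr_left imset_f.
  by rewrite inl_left; apply/esym/imsetP => -[].
by case: u v => [i|i] [j|j]; rewrite ?inl_left ?inr_left.
Qed.

End Kst.

Theorem theorem5p2 (s t k : nat) (hs : 0 < s) (hst : s <= t) (hk : 2 <= k) :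
  [/\ s < k -> k_coalition_number (Kst s t) k = 2,
      s = k -> k_coalition_number (Kst s t) k = 4,
      k + 1 <= s <= 3 * k - 2 ->
        k_coalition_number (Kst s t) k = t - k + 3
    & 3 * k - 1 <= s ->
        k_coalition_number (Kst s t) k = s + t - 4 * k + 4].
Proof.
have XY := Kst_complete_bipartite s t.
have cX := card_left_part s t; have cY := card_right_part s t.
have k0 := ltnW hk; have t0 := leq_trans hs hst.
(* The value is the larger of the two bounds. They agree at [s = 3 * k - 1], which is where the
   formula changes. *)
have large n : k < s -> t - k + 3 <= n -> s + t + 4 <= n + 4 * k ->
    k_coalition_number (Kst s t) k <= n.
  move=> ks n1 n2; apply: k_coalition_number_leq => P coalP.
  have [] := leq_card_large XY k0 _ _ coalP; rewrite ?cX ?cY //.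
    by move: n1 ks hst; move: #|P|; clear; lia.
  by move: n2; move: #|P|; clear; lia.
split=> [sk|sk|/andP[ks sk]|sk]; apply/eqP; rewrite eqn_leq; apply/andP; split.
- by apply: k_coalition_number_leq => P /(card_leq2_of_lt XY) -> //; rewrite ?cX ?cY.
- by apply: (k_coalition_number_geq2 XY) => //; rewrite ?cX ?cY.
- apply: k_coalition_number_leq => P /(card_leq4_of_eq XY) -> //; rewrite ?cX ?cY //.
  by rewrite -sk.
- by apply: (k_coalition_number_geq4 XY) => //; rewrite ?cX ?cY // -sk.
- by apply: large; move: ks sk hst; clear; lia.
- have := k_coalition_number_geq_right XY hk; rewrite cX cY; lia.
- by apply: large; move: hk sk hst; clear; lia.
(* Both sides have at least [2 * k] vertices because [2 * k <= 3 * k - 1]. *)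
- have := k_coalition_number_geq_both XY hk; rewrite cX cY; lia.
Qed.
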